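(* Let $N\ge2$, $1\le M<N$, $\gcd(M,N)=1$, and $\sigma\in\{+,-\}$; use the finite cyclic objects defined in the context. Then the source-normalized seam $S^{\rm VMY}_\sigma$ is Hermitian and traceless and satisfies, on $\mathbb C^2_A\otimes\mathbb C^2_B\otimes\mathbb C^2_C\otimes\mathbb C^N_a$, $$(W^{\rm VMY}_{\sigma,Ba})^\dagger\bigl[h_{BC}+S^{\rm VMY}_{\sigma,ABa}\bigr]W^{\rm VMY}_{\sigma,Ba}=h_{AB}+S^{\rm VMY}_{\sigma,BCa}.$$ Moreover, on a ring with $L\ge3$ sites, for every $\eta\in\mathbb Z_{2N}$ and every $k\in\mathbb Z_L$, $$(G_{\sigma,k}^{(\eta)})^\dagger H_\eta^\sigma(M;k)\,G_{\sigma,k}^{(\eta)}=H_\eta^\sigma(M;k+1),$$ where $G^{(\eta)}_{\sigma,k}$ is $W^{(\eta)}_\sigma$ acting on site $k$ and the endpoint. In particular, with $H_{\rm Weyl}^\sigma=H_0^\sigma$, $G_{\sigma,k}=G^{(0)}_{\sigma,k}$ and $H_{\rm VMY}^\sigma=H_{1-M}^\sigma$, $G^{\rm VMY}_{\sigma,k}=G^{(1-M)}_{\sigma,k}$, $$G_{\sigma,k}^\dagger H_{\rm Weyl}^\sigma(k)G_{\sigma,k}=H_{\rm Weyl}^\sigma(k+1),\qquad (G_{\sigma,k}^{\rm VMY})^\dagger H_{\rm VMY}^\sigma(M;k)G_{\sigma,k}^{\rm VMY}=H_{\rm VMY}^\sigma(M;k+1).$$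
   Context: Parameters: $\varepsilon=e^{i\pi/N}$, $q=\varepsilon^M$, $\omega=q^2$. Endpoint space $\mathbb C^N_a$ with basis $|1\rangle,\dots,|N\rangle$ (indices mod $N$): $Z|n\rangle=\omega^n|n\rangle$, $X|n\rangle=|n+1\rangle$, so $ZX=\omega XZ$. Write $Y_{m,n}=X^mZ^n$. A physical site is $\mathbb C^2$ with basis $|0\rangle,|1\rangle$; $\sigma^+=|0\rangle\langle1|$, $\sigma^-=|1\rangle\langle0|$, $\sigma^z=\operatorname{diag}(1,-1)$. Gates on $\mathbb C^2\otimes\mathbb C^N_a$ (the $(r,s)$ block multiplies $|r\rangle\langle s|$): $W_\sigma=L_\sigma/\sqrt2$, $$L_+=\begin{pmatrix}I&\omega X^{-1}\\ -qXZ&qZ\end{pmatrix},\qquad L_-=\begin{pmatrix}qZ&-qX^{-1}Z\\ X&\omega I\end{pmatrix}.$$ Bond density on an ordered pair: $h_{ij}=q\sigma_i^+\sigma_j^-+q^{-1}\sigma_i^-\sigma_j^++\frac{q+q^{-1}}4\sigma_i^z\sigma_j^z$. In the two-spin basis $|0\rangle=|00\rangle,|1\rangle=|01\rangle,|2\rangle=|10\rangle,|3\rangle=|11\rangle$ with $E_{rc}=|r\rangle\langle c|$ (tensor signs omitted): $$\begin{aligned}S_+=\tfrac12\bigl[&-E_{01}Y_{-1,-1}+q^3E_{02}Y_{-1,0}-q^4E_{03}Y_{-2,-1}-q^2E_{10}Y_{1,1}+q^2E_{12}Y_{0,1}-qE_{13}Y_{-1,0}\\ &+q^{-3}E_{20}Y_{1,0}+q^{-2}E_{21}Y_{0,-1}+q^2E_{23}Y_{-1,-1}-E_{30}Y_{2,1}-q^{-1}E_{31}Y_{1,0}+E_{32}Y_{1,1}\bigr],\\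 S_-=\tfrac12\bigl[&E_{01}Y_{-1,1}-qE_{02}Y_{-1,0}-E_{03}Y_{-2,1}+q^{-2}E_{10}Y_{1,-1}+q^2E_{12}Y_{0,-1}+q^3E_{13}Y_{-1,0}\\ &-q^{-1}E_{20}Y_{1,0}+q^{-2}E_{21}Y_{0,1}-q^{-2}E_{23}Y_{-1,1}-q^{-4}E_{30}Y_{2,-1}+q^{-3}E_{31}Y_{1,0}-E_{32}Y_{1,-1}\bigr].\end{aligned}$$ Output normalization: for $\eta\in\mathbb Z_{2N}$ let $f_\eta=\varepsilon^\eta$, $F_+^{(\eta)}=\operatorname{diag}(1,f_\eta)$, $F_-^{(\eta)}=\operatorname{diag}(f_\eta,1)$, $W_\sigma^{(\eta)}=F_\sigma^{(\eta)}W_\sigma$ ($F$ acting on the physical factor), and $S^{(\eta)}_{\sigma,ABa}=F^{(\eta)}_{\sigma,B}S_{\sigma,ABa}F^{(\eta)\dagger}_{\sigma,B}$ ($F$ acting on the second physical site $B$). The source-normalized objects are $W^{\rm VMY}_\sigma=W_\sigma^{(1-M)}$, $S^{\rm VMY}_\sigma=S^{(1-M)}_\sigma$ (i.e. $f=\varepsilon/q$). Ring: sites labelled by $\mathbb Z_L$, Hilbert space $(\mathbb C^2)^{\otimes L}\otimes\mathbb C^N_a$, and $$H_\eta^\sigma(M;k)=\sum_{j\in\mathbb Z_L,\ j\ne k-1}h_{j,j+1}+S^{(\eta)}_{\sigma,k-1,k,a}.$$ Subscripts on operators indicate the (ordered) tensor factors acted on, with identity elsewhere. *)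

(* Defs.v *)
From HB Require Import structures.
From mathcomp Require Import all_boot all_order all_algebra.
From mathcomp Require Import complex mxtens.
From mathcomp Require Import reals trigo.
Set Implicit Arguments.
Unset Strict Implicit.
Unset Printing Implicit Defensive.
Import Order.TTheory GRing.Theory Num.Theory.
Local Open Scope ring_scope.
Local Open Scope complex_scope.

(* Hermitian adjoint; spelled out because ["A ^t*"] clashes with the tensor
   power ["A ^t k"] of [mxtens]. *)
Notation dag A := (map_mx Num.conj (A^T)) (only parsing).

(* Dimension of the endpoint space C^N, whose basis is indexed by ['Z_N], so that
   |N> is the vector of index 0.  It is equal to [N] when [1 < N]; its shape makes
   operators on the endpoint a unit ring. *)
Notation edim N := ((Zp_trunc N).+2).

Variant sgn := Plus | Minus.

Section LocalOperators.
Variables (R : realType) (N M : nat).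
Local Notation C := R[i].

Definition eps : C := cos (pi / N%:R) +i* sin (pi / N%:R).
Definition q : C := eps ^+ M.
Definition omega : C := q ^+ 2.

(* Entry (m, n) of a matrix is <m|A|n>. *)
Definition X : 'M[C]_(edim N) := \matrix_(m, n) (m == n + 1)%:R.
Definition Z : 'M[C]_(edim N) := \matrix_(m, n) (omega ^+ n *+ (m == n)).
Definition Y (m n : int) : 'M[C]_(edim N) := X ^ m * Z ^ n.

(* |r><s| on a single site. *)
Definition ketbra (r s : 'I_2) : 'M[C]_2 := delta_mx r s.
Definition sigma_plus : 'M[C]_2 := ketbra 0 1.
Definition sigma_minus : 'M[C]_2 := ketbra 1 0.
Definition sigma_z : 'M[C]_2 := ketbra 0 0 - ketbra 1 1.

Definition h : 'M[C]_(2 * 2) :=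
  q *: (sigma_plus *t sigma_minus) + q^-1 *: (sigma_minus *t sigma_plus)
  + ((q + q^-1) / 4%:R) *: (sigma_z *t sigma_z).

Definition Lgate (sg : sgn) : 'M[C]_(2 * edim N) :=
  match sg with
  | Plus =>
      ketbra 0 0 *t 1 + ketbra 0 1 *t (omega *: X^-1)
      + ketbra 1 0 *t (- q *: (X * Z)) + ketbra 1 1 *t (q *: Z)
  | Minus =>
      ketbra 0 0 *t (q *: Z) + ketbra 0 1 *t (- q *: (X^-1 * Z))
      + ketbra 1 0 *t X + ketbra 1 1 *t (omega *: 1)
  end.

Definition Wgate (sg : sgn) : 'M[C]_(2 * edim N) :=
  ((Num.sqrt 2%:R)^-1)%:C *: Lgate sg.

(* c E_{rs} Y_{m,n}; since [mxtens_index (a, b) = 2 * a + b] on ['I_2 * 'I_2],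
   the index |ab> of ['M_(2 * 2)] is numbered 2a + b as required. *)
Definition EY (c : C) (r s : 'I_4) (m n : int) : 'M[C]_(2 * 2 * edim N) :=
  c *: ((delta_mx r s : 'M[C]_(2 * 2)) *t Y m n).

Definition Sseam (sg : sgn) : 'M[C]_(2 * 2 * edim N) :=
  2%:R^-1 *:
  match sg with
  | Plus =>
      EY (- 1) 0 1 (-1) (-1) + EY (q ^+ 3) 0 2 (-1) 0
      + EY (- q ^+ 4) 0 3 (-2) (-1)
      + EY (- q ^+ 2) 1 0 1 1 + EY (q ^+ 2) 1 2 0 1 + EY (- q) 1 3 (-1) 0
      + EY (q ^- 3) 2 0 1 0 + EY (q ^- 2) 2 1 0 (-1)
      + EY (q ^+ 2) 2 3 (-1) (-1)
      + EY (- 1) 3 0 2 1 + EY (- q^-1) 3 1 1 0 + EY 1 3 2 1 1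
  | Minus =>
      EY 1 0 1 (-1) 1 + EY (- q) 0 2 (-1) 0 + EY (- 1) 0 3 (-2) 1
      + EY (q ^- 2) 1 0 1 (-1) + EY (q ^+ 2) 1 2 0 (-1) + EY (q ^+ 3) 1 3 (-1) 0
      + EY (- q^-1) 2 0 1 0 + EY (q ^- 2) 2 1 0 1 + EY (- q ^- 2) 2 3 (-1) 1
      + EY (- q ^- 4) 3 0 2 (-1) + EY (q ^- 3) 3 1 1 0 + EY (- 1) 3 2 1 (-1)
  end.

(* [eps ^+ eta] does not depend on the representative of [eta] modulo 2N, as
   [eps ^+ (2 * N) = 1]. *)
Definition F (sg : sgn) (eta : 'Z_(2 * N)) : 'M[C]_2 :=
  let f := eps ^+ eta in
  match sg with
  | Plus => ketbra 0 0 + f *: ketbra 1 1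
  | Minus => f *: ketbra 0 0 + ketbra 1 1
  end.

Definition W_eta (sg : sgn) (eta : 'Z_(2 * N)) : 'M[C]_(2 * edim N) :=
  (F sg eta *t 1%:M) *m Wgate sg.

Definition S_eta (sg : sgn) (eta : 'Z_(2 * N)) : 'M[C]_(2 * 2 * edim N) :=
  let FB : 'M[C]_(2 * 2 * edim N) := 1%:M *t F sg eta *t 1%:M in
  FB *m Sseam sg *m dag FB.

Definition eta_VMY : 'Z_(2 * N) := 1 - M%:R.
Definition W_VMY (sg : sgn) := W_eta sg eta_VMY.
Definition S_VMY (sg : sgn) := S_eta sg eta_VMY.

End LocalOperators.

Section Embeddings.
Variables (R : realType) (N : nat) (T : finType).
Local Notation C := R[i].

(* Basis vectors of (C^2)^{(x) T} (x) C^N, with one qubit for each site in [T]. *)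
Definition basis : finType := ({ffun T -> 'I_2} * 'Z_N)%type.
Definition op := 'M[C]_#|basis|.

Definition agree_off (A : {set T}) (s t : {ffun T -> 'I_2}) : bool :=
  [forall l, (l \notin A) ==> (s l == t l)].

(* [on1a k O] is O_{k a}. *)
Definition on1a (k : T) (O : 'M[C]_(2 * edim N)) : op :=
  \matrix_(i, j)
    let s : basis := enum_val i in let t : basis := enum_val j in
    O (mxtens_index (s.1 k, s.2)) (mxtens_index (t.1 k, t.2))
      *+ agree_off [set k] s.1 t.1.

(* [on2a k l O] is O_{k l a}, for distinct sites [k] and [l]. *)
Definition on2a (k l : T) (O : 'M[C]_(2 * 2 * edim N)) : op :=
  \matrix_(i, j)
    let s : basis := enum_val i in let t : basis := enum_val j in
    O (mxtens_index (mxtens_index (s.1 k, s.1 l), s.2))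
      (mxtens_index (mxtens_index (t.1 k, t.1 l), t.2))
      *+ agree_off [set k; l] s.1 t.1.

(* [on2 k l O] is O_{k l}, for distinct sites [k] and [l]. *)
Definition on2 (k l : T) (O : 'M[C]_(2 * 2)) : op := on2a k l (O *t 1%:M).

End Embeddings.

Section Ring.
Variables (R : realType) (N M L : nat).

Definition H_eta (sg : sgn) (eta : 'Z_(2 * N)) (k : 'Z_L) : op R N 'Z_L :=
  \sum_(j : 'Z_L | j != k - 1) on2 N j (j + 1) (h R N M)
  + on2a (k - 1) k (S_eta R M sg eta).

Definition G_eta (sg : sgn) (eta : 'Z_(2 * N)) (k : 'Z_L) : op R N 'Z_L :=
  on1a k (W_eta R M sg eta).

Definition H_Weyl (sg : sgn) (k : 'Z_L) := H_eta sg 0 k.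
Definition G_Weyl (sg : sgn) (k : 'Z_L) := G_eta sg 0 k.
Definition H_VMY (sg : sgn) (k : 'Z_L) := H_eta sg (eta_VMY N M) k.
Definition G_VMY (sg : sgn) (k : 'Z_L) := G_eta sg (eta_VMY N M) k.

End Ring.

(* Sites of the three-spin space C^2_A (x) C^2_B (x) C^2_C (x) C^N. *)
Definition sA : 'I_3 := 0.
Definition sB : 'I_3 := 1.
Definition sC : 'I_3 := 2%:R.

(* Main.v *)
(* The output phase [f = eps^eta] and [q] enter the local identities only through
   [f f^* = q q^* = 1] and [Z X = q^2 X Z], so all of these are identities between
   matrices over the algebra generated by commuting units [q], [f] and a Weyl pair
   [X], [Z], with a monomial basis [q^a f^b X^m Z^n].  Written in this basis, the
   hermiticity of the seam, the unitarity of the gate, its commutation with the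
   distant bonds and the intertwining relation on three sites are decided by
   computation.  Extending operators from three sites to the ring along an injection
   of sites is a *-homomorphism; on the ring the gate at [k] is unitary and commutes
   with every bond not touching [k], so only the three-site relation for [k-1], [k],
   [k+1] remains. *)
Require Import Defs.
From mathcomp Require Import all_boot all_order all_algebra.
From mathcomp Require Import complex mxtens.
From mathcomp Require Import reals trigo.
Import Order.TTheory GRing.Theory Num.Theory.
Set Implicit Arguments.
Unset Strict Implicit.
Unset Printing Implicit Defensive.
Local Open Scope ring_scope.
Local Open Scope complex_scope.

(** * Adjoints of square matrices *)

Section Adjoint.
Variables (C : numClosedFieldType) (n : nat).

Lemma dagM (A B : 'M[C]_n) : dag (A *m B) = dag B *m dag A.
Proof. by rewrite trmx_mul map_mxM. Qed.

Lemma dagZ (c : C) (A : 'M[C]_n) : dag (c *: A) = Num.conj c *: dag A.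
Proof. by rewrite linearZ /= map_mxZ. Qed.

Lemma dagD (A B : 'M[C]_n) : dag (A + B) = dag A + dag B.
Proof. by rewrite linearD /= map_mxD. Qed.

Lemma dagK (A : 'M[C]_n) : dag (dag A) = A.
Proof. by apply/matrixP=> i j; rewrite !mxE conjCK. Qed.

End Adjoint.

(** * Integer powers of a Weyl pair *)

Section WeylPair.
Variables (C : fieldType) (A : unitAlgType C) (c : C) (u v : A).
Hypotheses (c0 : c != 0) (Uu : u \is a GRing.unit) (Uv : v \is a GRing.unit).
Hypothesis uv : u * v = c *: (v * u).

Lemma weyl_exprl (n : int) : u ^ n * v = c ^ n *: (v * u ^ n).
Proof.
have nat_case k : u ^+ k * v = c ^+ k *: (v * u ^+ k).
  elim: k => [|k IH]; first by rewrite !expr0 mul1r mulr1 scale1r.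
  by rewrite [u ^+ _]exprSr -mulrA uv -scalerAr !mulrA IH -scalerAl scalerA -exprS.
case: n => k; first exact: nat_case.
rewrite NegzE -!exprnN.
have Uk : u ^+ k.+1 \is a GRing.unit by rewrite unitrX.
(* For a negative exponent, cancelling [u ^+ k.+1] on the left reduces the claim to [nat_case]. *)
apply: (mulrI Uk); rewrite mulrA divrr // mul1r -scalerAr mulrA nat_case.
by rewrite -scalerAl scalerA mulVf ?expf_neq0 // scale1r -mulrA divrr // mulr1.
Qed.

End WeylPair.

(** Two passes of [weyl_exprl]: the first makes [v], [u ^ n] a Weyl pair with constant [c ^ - n],
    and the second, applied to that pair with exponent [m], is then solved for [u ^ n * v ^ m]. *)
Lemma weyl_expr (C : fieldType) (A : unitAlgType C) (c : C) (u v : A) (m n : int) :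
  c != 0 -> u \is a GRing.unit -> v \is a GRing.unit ->
  u * v = c *: (v * u) -> u ^ n * v ^ m = c ^ (n * m) *: (v ^ m * u ^ n).
Proof.
move=> c0 Uu Uv uv.
have uvn := weyl_exprl c0 Uu uv n.
have vun : v * u ^ n = (c ^ - n) *: (u ^ n * v).
  by rewrite uvn scalerA -expfzDr // addNr expr0z scale1r.
have := @weyl_exprl C A (c ^ - n) v (u ^ n) _ Uv vun m.
move=> ->; last by rewrite expfz_neq0.
by rewrite scalerA exprz_exp -expfzDr // mulNr subrr expr0z scale1r.
Qed.

(** * The phases, and unitarity and commutation of the endpoint operators *)

Section Endpoint.
Variables (R : realType) (N M : nat).
Hypothesis hN : (1 < N)%N.
Local Notation C := R[i].
Local Notation eps := (eps R N).
Local Notation q := (q R N M).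
Local Notation omega := (omega R N M).
Local Notation X := (X R N).
Local Notation Z := (Z R N M).
Local Notation A := 'M[C]_(edim N).

Lemma cis_expr (x : R) n :
  (cos x +i* sin x : C) ^+ n = cos (x *+ n) +i* sin (x *+ n).
Proof.
elim: n => [|n IH]; first by rewrite mulr0n cos0 sin0.
by rewrite exprS IH mulrS cosD sinD; congr (_ +i* _); rewrite addrC [X in _ + X]mulrC.
Qed.

Lemma eps_norm : eps * Num.conj eps = 1.
Proof.
apply/eqP; rewrite eq_complex /= /eps /= mulrN opprK -!expr2 cos2Dsin2 eqxx /=.
by rewrite mulrN mulrC addNr.
Qed.

Lemma eps_neq0 : eps != 0.
Proof.
by apply/eqP => e0; have := eps_norm; rewrite e0 mul0r => /esym/eqP; rewrite oner_eq0.
Qed.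

Lemma conj_eps : Num.conj eps = eps^-1.
Proof. by apply: (mulfI eps_neq0); rewrite eps_norm divff ?eps_neq0. Qed.

Lemma eps_expr2N : eps ^+ (2 * N) = 1.
Proof.
have N0 : N%:R != 0 :> R by rewrite pnatr_eq0 -lt0n ltnW.
by rewrite /eps cis_expr mulnC mulrnA -[_ *+ N]mulr_natr divfK // cos2pi sin2pi.
Qed.

Lemma q_neq0 : q != 0. Proof. exact: expf_neq0 eps_neq0. Qed.

Lemma conj_q : Num.conj q = q^-1.
Proof. by rewrite /q rmorphXn /= conj_eps exprVn. Qed.

Lemma omega_neq0 : omega != 0. Proof. exact: expf_neq0 q_neq0. Qed.

Lemma omega_exprN : omega ^+ N = 1.
Proof. by rewrite /omega /q -exprM exprAC eps_expr2N expr1n. Qed.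

Lemma Z_diag : Z = diag_mx (\row_n omega ^+ n).
Proof. by apply/matrixP => i j; rewrite !mxE; case: eqP => // ->. Qed.

Lemma dagX_mul : dag X * X = 1.
Proof.
apply/matrixP => i j; rewrite !mxE (bigD1 (j + 1)) //= big1 => [|k kj].
  rewrite !mxE eqxx mulr1 addr0 conjC_nat (inj_eq (addIr 1)) eq_sym.
  exact: erefl.
by rewrite [X k j]mxE (negbTE kj) mulr0.
Qed.

Lemma dagZ_mul : dag Z * Z = 1.
Proof.
rewrite Z_diag tr_diag_mx map_diag_mx [LHS]mulmx_diag; apply/matrixP => i j.
rewrite !mxE rmorphXn /= /omega rmorphXn /= conj_q -exprMn -exprMn mulVf ?q_neq0 //.
by rewrite !expr1n.
Qed.

Lemma unitX : X \is a GRing.unit.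
Proof. by case: (mulmx1_unit dagX_mul). Qed.

Lemma unitZ : Z \is a GRing.unit.
Proof. by case: (mulmx1_unit dagZ_mul). Qed.

Lemma ZX : Z * X = omega *: (X * Z).
Proof.
(* The shift in [X] wraps around modulo [edim N], so the power of [omega] read off at the row
   [j + 1] must depend only on the exponent modulo [edim N]. *)
have omegaE : omega ^+ edim N = 1 by rewrite Zp_cast // omega_exprN.
apply/matrixP => i j; rewrite [RHS]mxE.
have -> : (Z * X) i j = omega ^+ i * X i j.
  by rewrite Z_diag -[LHS]/((diag_mx _ *m X) i j) mul_diag_mx !mxE.
have -> : (X * Z) i j = X i j * omega ^+ j.
  by rewrite Z_diag -[LHS]/((X *m diag_mx _) i j) mul_mx_diag !mxE.
rewrite !mxE; case: eqP => [->|_]; last by rewrite mulr0 mul0r mulr0.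
by rewrite mulr1 mul1r [nat_of_ord _]/= expr_mod // exprD expr_mod // expr1 mulrC.
Qed.

Lemma ZX_exprz (m n : int) : Z ^ n * X ^ m = omega ^ (n * m) *: (X ^ m * Z ^ n).
Proof. exact: (weyl_expr m n omega_neq0 unitZ unitX ZX). Qed.

Lemma dag_expz (U : A) n : U \is a GRing.unit -> dag U * U = 1 -> dag (U ^ n) = U ^ (- n).
Proof.
move=> UU dU; have {}dU : dag U = U^-1 by apply: (mulIr UU); rewrite dU mulVr.
have natc k : dag (U ^+ k) = U ^- k.
  elim: k => [|k IH]; first by rewrite !expr0 invr1 trmx1 map_mx1.
  by rewrite exprS dagM IH dU -[LHS]/(U ^- k * U^-1) -invrM ?unitrX // -exprS.
case: n => k; first by rewrite -exprnN; exact: natc.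
(* The negative case is the adjoint of the natural one, since the adjoint is an involution. *)
rewrite NegzE opprK -exprnN -[RHS]dagK; congr (map_mx _ _^T); exact/esym/natc.
Qed.

End Endpoint.

(** * Computation in the Weyl algebra *)

Definition wexp : Type := int * int * int * int.
(* [(c, (a, b, m, n))] stands for the term [c q^a f^b X^m Z^n], where [f] is the
   output phase. *)
Definition wpoly : Type := seq (int * wexp).
(* [f i j] is the block of row [i] and column [j]. *)
Definition wmat : Type := nat -> nat -> wpoly.

(** The term [2 * (n * m')] is the price of moving [Z ^ n] to the right of [X ^ m'], as
    [omega = q ^+ 2]. *)
Definition tmul (s t : int * wexp) : int * wexp :=
  let: (c, (a, b, m, n)) := s in let: (c', (a', b', m', n')) := t in
  (c * c', (a + a' + 2 * (n * m'), b + b', m + m', n + n')).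
(** Conjugation inverts the phases [q] and [f]; the adjoint [Z ^ (- n) * X ^ (- m)] is put back in
    normal order at the cost of [q ^ (2 * (n * m))]. *)
Definition tdag (s : int * wexp) : int * wexp :=
  let: (c, (a, b, m, n)) := s in (c, (- a + 2 * (n * m), - b, - m, - n)).
Definition wmul (u v : wpoly) : wpoly := [seq tmul s t | s <- u, t <- v].
Definition wdag (u : wpoly) : wpoly := map tdag u.
Definition wscale (k : int) (u : wpoly) : wpoly := [seq (k * t.1, t.2) | t <- u].

Fixpoint winsert (t : int * wexp) (u : wpoly) : wpoly :=
  if u is s :: u' then
    if s.2 == t.2 then (s.1 + t.1, s.2) :: u' else s :: winsert t u'
  else [:: t].
(** A sufficient test for vanishing, with [q] and [f] treated as free commuting units although they
    are roots of unity. A success therefore holds for all parameters at once. *)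
Definition wnull (u : wpoly) : bool := all (fun t => t.1 == 0) (foldr winsert [::] u).

Definition wone : wpoly := [:: (1, (0, 0, 0, 0))].
Definition madd (f g : wmat) : wmat := fun i j => f i j ++ g i j.
Definition mscale (k : int) (f : wmat) : wmat := fun i j => wscale k (f i j).
Definition mscalep (w : wpoly) (f : wmat) : wmat := fun i j => wmul w (f i j).
Definition mdag (f : wmat) : wmat := fun i j => wdag (f j i).
Definition mmul (K : nat) (f g : wmat) : wmat :=
  fun i j => flatten [seq wmul (f i k) (g k j) | k <- iota 0 K].
Definition mdelta (r s : nat) (w : wpoly) : wmat :=
  fun i j => if (i == r) && (j == s) then w else [::].
Definition mid : wmat := fun i j => if i == j then wone else [::].
(** The second factor lives on one spin, so quotient and remainder by 2 decode [mxtens_index].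
    Multiplying entries models the tensor product of matrices with scalar entries. *)
Definition mtens (f g : wmat) : wmat :=
  fun i j => wmul (f (i %/ 2)%N (j %/ 2)%N) (g (i %% 2)%N (j %% 2)%N).
Definition meqb (K : nat) (f g : wmat) : bool :=
  all (fun i => all (fun j => wnull (f i j ++ wscale (-1) (g i j))) (iota 0 K))
    (iota 0 K).

(** * Soundness of the symbolic operations under evaluation *)

Section Evaluation.
Variables (R : realType) (N M : nat) (f : R[i]).
Hypotheses (hN : (1 < N)%N) (f0 : f != 0) (conj_f : Num.conj f = f^-1).
Local Notation C := R[i].
Local Notation q := (q R N M).
Local Notation omega := (omega R N M).
Local Notation X := (X R N).
Local Notation Z := (Z R N M).
Local Notation Y := (Y R N M).
Local Notation A := 'M[C]_(edim N).

Definition evt (t : int * wexp) : A :=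
  let: (c, (a, b, m, n)) := t in (c%:~R * q ^ a * f ^ b) *: Y m n.
Definition ev (u : wpoly) : A := \sum_(t <- u) evt t.

Lemma omega_exprz (k : int) : omega ^ k = q ^ (2 * k).
Proof. by rewrite /omega -exprz_exp. Qed.

Lemma mulY m n m' n' : Y m n * Y m' n' = q ^ (2 * (n * m')) *: Y (m + m') (n + n').
Proof.
rewrite /Y -!mulrA [Z ^ n * _]mulrA.
rewrite (ZX_exprz R M hN).
rewrite -scalerAl -scalerAr omega_exprz; congr (_ *: _).
by rewrite exprzDr ?unitX // exprzDr ?unitZ // !mulrA.
Qed.

Lemma dagY m n : dag (Y m n) = q ^ (2 * (n * m)) *: Y (- m) (- n).
Proof.
rewrite [LHS]dagM !dag_expz ?unitX ?unitZ ?dagX_mul ?dagZ_mul //.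
rewrite -[_ *m _]/(Z ^ (- n) * X ^ (- m)).
rewrite (ZX_exprz R M hN).
by rewrite omega_exprz mulrNN.
Qed.

Lemma evt_mul s t : evt s * evt t = evt (tmul s t).
Proof.
case: s => c [[[a b] m] n]; case: t => c' [[[a' b'] m'] n'] /=.
rewrite -scalerAl -scalerAr mulY !scalerA; congr (_ *: _).
rewrite intrM !expfzDr ?q_neq0 // [X in X * _ = _]mulrACA [LHS]mulrAC.
by congr (_ * _); rewrite [X in X * _ = _]mulrACA !mulrA.
Qed.

Lemma conj_expz (z : C) (n : int) : Num.conj z = z^-1 -> Num.conj (z ^ n) = z ^ - n.
Proof. by move=> zz; rewrite fmorphXz /= zz exprz_inv. Qed.

Lemma evt_dag t : dag (evt t) = evt (tdag t).
Proof.
case: t => c [[[a b] m] n] /=; rewrite dagZ dagY scalerA; congr (_ *: _).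
rewrite !rmorphM /= !conj_expz ?conj_q // rmorph_int.
by rewrite expfzDr ?q_neq0 // -!mulrA [_ * q ^ (2 * _)]mulrC.
Qed.

Lemma ev_nil : ev [::] = 0.
Proof. exact: big_nil. Qed.

Lemma ev_cat u v : ev (u ++ v) = ev u + ev v.
Proof. exact: big_cat. Qed.

Lemma ev_mul u v : ev (wmul u v) = ev u * ev v.
Proof.
rewrite /ev big_allpairs_dep mulr_suml; apply: eq_bigr => s _.
by rewrite mulr_sumr; apply: eq_bigr => t _; rewrite evt_mul.
Qed.

Lemma ev_dag u : ev (wdag u) = dag (ev u).
Proof.
rewrite /ev big_map; elim: u => [|t u IH]; first by rewrite !big_nil trmx0 map_mx0.
by rewrite !big_cons IH dagD evt_dag.
Qed.

Lemma ev_scale k u : ev (wscale k u) = k%:~R *: ev u.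
Proof.
rewrite /ev big_map scaler_sumr; apply: eq_bigr => -[c [[[a b] m] n]] _ /=.
by rewrite scalerA intrM !mulrA.
Qed.

Lemma ev_one : ev wone = 1.
Proof. by rewrite /ev big_seq1 /= !expr0z !mulr1 scale1r /Y !expr0z mulr1. Qed.

Lemma ev_insert t u : ev (winsert t u) = evt t + ev u.
Proof.
elim: u => [|s u IH] /=; first by rewrite /ev big_seq1 big_nil addr0.
case: eqP => st; rewrite /ev !big_cons -/(ev _); last by rewrite IH addrCA.
rewrite addrA; congr (_ + _); case: s t st {IH} => c k [c' _] /= <-.
by case: k => [[[a b] m] n]; rewrite -scalerDl intrD !mulrDl addrC.
Qed.

Lemma ev_null u : wnull u -> ev u = 0.
Proof.
have -> : ev u = ev (foldr winsert [::] u).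
  by elim: u => //= t u IH; rewrite ev_insert -IH /ev big_cons.
rewrite /wnull; elim: (foldr _ _ _) => [_|[c [[[a b] m] n]] v IH /= /andP [/eqP -> /IH]].
  by rewrite /ev big_nil.
by rewrite /ev big_cons => ->; rewrite /= !mul0r scale0r addr0.
Qed.

(** * Matrices cut into endpoint blocks, and their symbolic representation *)

Section Blocks.
Variables (K d : nat) (e : 'I_K -> 'Z_N -> 'I_d).
Hypothesis e_bij : bijective (fun x : 'I_K * 'Z_N => e x.1 x.2).

Definition block (P : 'M[C]_d) (i j : 'I_K) : A := \matrix_(m, n) P (e i m) (e j n).
(** The scalar [c] carries factors such as the inverse of the square root of 2, which polynomials
    with integer coefficients cannot express. *)
Definition represents (c : C) (g : wmat) (P : 'M[C]_d) : Prop :=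
  forall i j : 'I_K, block P i j = c *: ev (g i j).

Lemma block_sum (G : 'I_d -> C) : \sum_x G x = \sum_(i < K) \sum_(m : 'Z_N) G (e i m).
Proof.
rewrite (reindex (fun x : 'I_K * 'Z_N => e x.1 x.2)) /=; last exact: onW_bij.
by rewrite pair_bigA.
Qed.

Lemma represents_add c g g' P P' :
  represents c g P -> represents c g' P' -> represents c (madd g g') (P + P').
Proof.
move=> gP gP' i j; rewrite ev_cat scalerDr -gP -gP'.
by apply/matrixP => m n; rewrite !mxE.
Qed.

Lemma represents_scaler c k g P : represents c g P -> represents (k * c) g (k *: P).
Proof.
by move=> gP i j; rewrite -scalerA -gP; apply/matrixP => m n; rewrite !mxE.
Qed.

(** Moves an integer factor from the scalar into the polynomials, so that two representations can be
    brought to the same scalar before being added or compared. *)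
Lemma represents_rescale c k g P :
  represents (k%:~R * c) g P -> represents c (mscale k g) P.
Proof. by move=> gP i j; rewrite ev_scale gP scalerA mulrC. Qed.

Lemma represents_mul c c' g g' P P' :
  represents c g P -> represents c' g' P' ->
  represents (c * c') (mmul K g g') (P *m P').
Proof.
(* Writing [iota 0 K] as [iota 0 (K - 0)] exhibits it as [index_iota 0 K], the form [big_mkord]
   expects. *)
move=> gP gP' i j; rewrite /ev big_flatten big_map -[iota 0 K](congr1 (iota 0) (subn0 K)).
rewrite big_mkord scaler_sumr.
transitivity (\sum_(k < K) block P i k * block P' k j); last first.
  apply: eq_bigr => k _; rewrite gP gP' -/(ev _) ev_mul.
  by rewrite -scalerAl -scalerAr scalerA.
apply/matrixP => m n; rewrite !mxE block_sum summxE; apply: eq_bigr => k _.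
by rewrite !mxE; apply: eq_bigr => l _; rewrite !mxE.
Qed.

Lemma represents_dag c g P : represents c g P -> represents (Num.conj c) (mdag g) (dag P).
Proof.
move=> gP i j; rewrite ev_dag -dagZ -gP.
by apply/matrixP => m n; rewrite !mxE.
Qed.

(** The reflection principle: a matrix identity follows from a boolean test on symbolic blocks. The
    blocks determine the matrix because [e] reaches every index. *)
Lemma represents_eq c g g' P P' :
  represents c g P -> represents c g' P' -> meqb K g g' -> P = P'.
Proof.
move=> gP gP' /allP gg'; have blockE i j : block P i j = block P' i j.
  have iK (k : 'I_K) : val k \in iota 0 K by rewrite mem_iota /=.
  rewrite gP gP'; congr (_ *: _); apply/eqP; rewrite -subr_eq0; apply/eqP.
  have /allP/(_ _ (iK j))/ev_null := gg' _ (iK i).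
  by rewrite ev_cat ev_scale scaleN1r.
case: e_bij => e' eK e'K; apply/matrixP => x y.
rewrite -[x]e'K -[y]e'K; set u := e' x; set v := e' y.
by have := congr1 (fun B : A => B u.2 v.2) (blockE u.1 v.1); rewrite !mxE.
Qed.

(** The trace is the sum of the traces of the diagonal blocks, and these blocks are symbolically
    zero. *)
Lemma represents_tr0 c g P :
  represents c g P -> all (fun i => wnull (g i i)) (iota 0 K) -> \tr P = 0.
Proof.
move=> gP /allP g0; rewrite /mxtrace block_sum big1 // => i _.
transitivity (\tr (block P i i)); first by apply: eq_bigr => m _; rewrite !mxE.
by rewrite gP ev_null ?scaler0 ?mxtrace0 // g0 // mem_iota /=.
Qed.

Lemma represents_one : represents 1 mid 1%:M.
Proof.
move=> i j; rewrite scale1r /mid; apply/matrixP => m n; rewrite !mxE.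
have -> : (e i m == e j n) = ((i, m) == (j, n)).
  exact: (inj_eq (bij_inj e_bij) (i, m) (j, n)).
rewrite xpair_eqE -val_eqE; case: (_ == _) => /=; first by rewrite ev_one !mxE.
by rewrite /ev big_nil mxE.
Qed.

End Blocks.

End Evaluation.

(** * The gate, the bond density and the seam as block matrices *)

Definition wterm (c a b m n : int) : wpoly := [:: (c, (a, b, m, n))].

Definition wF (sg : sgn) : wmat :=
  match sg with
  | Plus => madd (mdelta 0 0 wone) (mdelta 1 1 (wterm 1 0 1 0 0))
  | Minus => madd (mdelta 0 0 (wterm 1 0 1 0 0)) (mdelta 1 1 wone)
  end.

Definition wL (sg : sgn) : wmat :=
  match sg with
  | Plus =>
      madd (madd (madd (mdelta 0 0 wone) (mdelta 0 1 (wterm 1 2 0 (-1) 0)))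
        (mdelta 1 0 (wterm (-1) 1 0 1 1))) (mdelta 1 1 (wterm 1 1 0 0 1))
  | Minus =>
      madd (madd (madd (mdelta 0 0 (wterm 1 1 0 0 1))
        (mdelta 0 1 (wterm (-1) 1 0 (-1) 1)))
        (mdelta 1 0 (wterm 1 0 0 1 0))) (mdelta 1 1 (wterm 1 2 0 0 0))
  end.

(* Represents [4 h]. *)
Definition wh : wmat :=
  madd (madd (mscalep (wterm 4 1 0 0 0) (mtens (mdelta 0 1 wone) (mdelta 1 0 wone)))
      (mscalep (wterm 4 (-1) 0 0 0) (mtens (mdelta 1 0 wone) (mdelta 0 1 wone))))
    (mscalep (wterm 1 1 0 0 0 ++ wterm 1 (-1) 0 0 0)
      (mtens (madd (mdelta 0 0 wone) (mdelta 1 1 (wterm (-1) 0 0 0 0)))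
         (madd (mdelta 0 0 wone) (mdelta 1 1 (wterm (-1) 0 0 0 0))))).

Definition wEY (c a : int) (r s : nat) (m n : int) : wmat := mdelta r s (wterm c a 0 m n).

(* Represents [2 S]. *)
Definition wS (sg : sgn) : wmat :=
  match sg with
  | Plus =>
      madd (madd (madd (madd (madd (madd (madd (madd (madd (madd (madd
        (wEY (-1) 0 0 1 (-1) (-1)) (wEY 1 3 0 2 (-1) 0))
        (wEY (-1) 4 0 3 (-2) (-1)))
        (wEY (-1) 2 1 0 1 1)) (wEY 1 2 1 2 0 1)) (wEY (-1) 1 1 3 (-1) 0))
        (wEY 1 (-3) 2 0 1 0)) (wEY 1 (-2) 2 1 0 (-1)))
        (wEY 1 2 2 3 (-1) (-1)))
        (wEY (-1) 0 3 0 2 1)) (wEY (-1) (-1) 3 1 1 0)) (wEY 1 0 3 2 1 1)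
  | Minus =>
      madd (madd (madd (madd (madd (madd (madd (madd (madd (madd (madd
        (wEY 1 0 0 1 (-1) 1) (wEY (-1) 1 0 2 (-1) 0)) (wEY (-1) 0 0 3 (-2) 1))
        (wEY 1 (-2) 1 0 1 (-1))) (wEY 1 2 1 2 0 (-1))) (wEY 1 3 1 3 (-1) 0))
        (wEY (-1) (-1) 2 0 1 0)) (wEY 1 (-2) 2 1 0 1)) (wEY (-1) (-2) 2 3 (-1) 1))
        (wEY (-1) (-4) 3 0 2 (-1))) (wEY 1 (-3) 3 1 1 0)) (wEY (-1) 0 3 2 1 (-1))
  end.

Definition wFL (sg : sgn) : wmat := mmul 2 (wF sg) (wL sg).
(* Represents [4 S^(eta)]. *)
Definition wFSF (sg : sgn) : wmat :=
  let FB := mtens mid (wF sg) in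
  mmul 4 (mmul 4 FB (mscale 2 (wS sg))) (mdag FB).

Lemma tensZl (C : comPzRingType) m n k l (c : C) (P : 'M_(m, n)) (Q : 'M_(k, l)) :
  (c *: P) *t Q = c *: (P *t Q).
Proof. by apply/matrixP => i j; rewrite !mxE mulrA. Qed.

Lemma tensZr (C : comPzRingType) m n k l (c : C) (P : 'M_(m, n)) (Q : 'M_(k, l)) :
  P *t (c *: Q) = c *: (P *t Q).
Proof. by apply/matrixP => i j; rewrite !mxE mulrCA. Qed.

Section LocalRepresentations.
Variables (R : realType) (N M : nat) (sg : sgn) (eta : 'Z_(2 * N)).
Hypothesis hN : (1 < N)%N.
Local Notation C := R[i].
Local Notation q := (q R N M).
Local Notation A := 'M[C]_(edim N).
Local Notation f := (eps R N ^+ eta).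
Local Notation ev := (@ev R N M f).

Lemma phase_neq0 : f != 0. Proof. exact: expf_neq0 (eps_neq0 R N). Qed.

Lemma conj_phase : Num.conj f = f^-1.
Proof. by rewrite rmorphXn /= conj_eps exprVn. Qed.

Lemma ev_term c a b m n : ev (wterm c a b m n) = (c%:~R * q ^ a * f ^ b) *: Y R N M m n.
Proof. by rewrite /ev big_seq1. Qed.

Lemma ev_scalar c a b : ev (wterm c a b 0 0) = (c%:~R * q ^ a * f ^ b) *: 1.
Proof. by rewrite ev_term /Y !expr0z mulr1. Qed.

(** For operators on spins alone, whose entries are scalars: tensor products are formed at this
    level, and [represents_tens] adjoins the endpoint afterwards. *)
Definition represents_entries (K : nat) (g : wmat) (P : 'M[C]_K) : Prop :=
  forall i j, P i j *: (1 : A) = ev (g i j).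

Lemma entries_delta (K : nat) (r s : 'I_K) w c :
  c *: 1 = ev w -> represents_entries (mdelta r s w) (c *: delta_mx r s).
Proof.
move=> cw i j; rewrite !mxE /mdelta !val_eqE.
case: (_ && _); first by rewrite mulr1.
by rewrite mulr0 scale0r ev_nil.
Qed.

Lemma entries_delta1 (K : nat) (r s : 'I_K) :
  represents_entries (mdelta r s wone) (delta_mx r s).
Proof. by rewrite -[delta_mx r s]scale1r; apply: entries_delta; rewrite ev_one scale1r. Qed.

Lemma entries_add (K : nat) g g' (P P' : 'M[C]_K) :
  represents_entries g P -> represents_entries g' P' ->
  represents_entries (madd g g') (P + P').
Proof. by move=> gP gP' i j; rewrite ev_cat -gP -gP' mxE scalerDl. Qed.

Lemma entries_scale (K : nat) c w g (P : 'M[C]_K) :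
  c *: 1 = ev w -> represents_entries g P -> represents_entries (mscalep w g) (c *: P).
Proof.
move=> cw gP i j; rewrite /mscalep ev_mul ?phase_neq0 // -cw -gP mxE.
by rewrite -scalerAl mul1r scalerA.
Qed.

Lemma entries_one (K : nat) : represents_entries mid (1%:M : 'M[C]_K).
Proof.
move=> i j; rewrite mxE /mid val_eqE.
by case: eqP => _; rewrite ?ev_one ?scale1r // scale0r ev_nil.
Qed.

Lemma entries_tens g g' (P P' : 'M[C]_2) :
  represents_entries g P -> represents_entries g' P' ->
  represents_entries (mtens g g') (P *t P').
Proof.
move=> gP gP' i j.
case: (mxtens_indexP i) => i1 i2; case: (mxtens_indexP j) => j1 j2.
rewrite tensmxE /mtens ev_mul ?phase_neq0 //= !divnMDl // !modnMDl !divn_small //.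
by rewrite !modn_small // !addn0 -gP -gP' -scalerAl mul1r scalerA.
Qed.

Definition tens_index (n : nat) (i : 'I_n) (m : 'Z_N) : 'I_(n * edim N) :=
  mxtens_index (i, m).

Lemma tens_index_bij n :
  bijective (fun x : 'I_n * 'Z_N => tens_index x.1 x.2).
Proof.
exists (@mxtens_unindex n (edim N)) => [[i m]|k]; first exact: mxtens_indexK.
by rewrite /tens_index -surjective_pairing mxtens_unindexK.
Qed.

Notation represents := (represents M f).

Lemma represents_tens n g (P : 'M[C]_n) :
  represents_entries g P -> represents (@tens_index n) 1 g (P *t 1%:M).
Proof.
move=> gP i j; rewrite scale1r -gP; apply/matrixP => k l.
by rewrite mxE tensmxE [RHS]mxE.
Qed.

Lemma represents_delta n (r s : 'I_n) w (B : A) :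
  B = ev w -> represents (@tens_index n) 1 (mdelta r s w) (delta_mx r s *t B).
Proof.
move=> -> i j; rewrite scale1r; apply/matrixP => k l.
rewrite mxE tensmxE mxE /mdelta !val_eqE.
by case: (_ && _); rewrite ?mul1r // mul0r ev_nil mxE.
Qed.

Lemma entries_F : represents_entries (wF sg) (F R sg eta).
Proof.
have ef : f *: 1 = ev (wterm 1 0 1 0 0) by rewrite ev_scalar !mul1r.
rewrite /F; case: sg; apply: entries_add; first [exact: entries_delta1 | exact: entries_delta].
Qed.

Lemma represents_L : represents (@tens_index 2) 1 (wL sg) (Lgate R N M sg).
Proof.
rewrite /Lgate; case: sg; do ! apply: represents_add; apply: represents_delta;
  by rewrite ?ev_one // ev_term /Y !expr0z ?mul1r ?mulr1 ?mulN1r ?scale1r.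
Qed.

Lemma represents_EY (c : C) (k a : int) (r s : 'I_4) m n :
  c = k%:~R * q ^ a ->
  represents (@tens_index (2 * 2)) 1 (wEY k a r s m n) (EY N M c r s m n).
Proof.
by move=> ->; rewrite /EY -tensZr; apply: represents_delta; rewrite ev_term expr0z mulr1.
Qed.

Lemma represents_S : represents (@tens_index (2 * 2)) 2^-1 (wS sg) (Sseam R N M sg).
Proof.
rewrite -[2^-1]mulr1 /Sseam; apply: represents_scaler.
case: sg; do ! apply: represents_add; apply: represents_EY;
  by rewrite ?mulrN1z ?mulr1z ?mul1r ?mulN1r ?expr0z ?exprN1 ?exprnN ?exprnP.
Qed.

Lemma represents_h :
  represents (@tens_index (2 * 2)) 4^-1 wh (h R N M *t 1%:M).
Proof.
rewrite -[4^-1]mulr1.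
have n4 : (4 : C) != 0 by rewrite pnatr_eq0.
(* Clearing the denominator 4 leaves integer coefficients. *)
have -> : h R N M = 4^-1 *: ((4 * q) *: (sigma_plus R *t sigma_minus R)
    + (4 * q^-1) *: (sigma_minus R *t sigma_plus R)
    + (q + q^-1) *: (sigma_z R *t sigma_z R)).
  by rewrite !scalerDr !scalerA !mulrA mulVf // !mul1r [4^-1 * _]mulrC.
rewrite (tensZl 4^-1).
apply/represents_scaler/represents_tens.
have ev_q k c : (k%:~R * q ^ c) *: 1 = ev (wterm k c 0 0 0) by rewrite ev_scalar mulr1.
have rsz : represents_entries (madd (mdelta 0 0 wone) (mdelta 1 1 (wterm (-1) 0 0 0 0)))
    (sigma_z R).
  apply: entries_add; first exact: entries_delta1.
  by rewrite -scaleN1r; apply: entries_delta; rewrite -ev_q mulr1.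
apply: entries_add; first apply: entries_add.
- apply: entries_scale; first exact: (ev_q 4 1).
  by apply: entries_tens; apply: entries_delta1.
- apply: entries_scale; first exact: (ev_q 4 (-1)).
  by apply: entries_tens; apply: entries_delta1.
apply: entries_scale; last exact: entries_tens.
by rewrite ev_cat -!ev_q !mul1r scalerDl.
Qed.

Definition inv_sqrt2 : C := ((Num.sqrt 2)^-1)%:C.

Lemma represents_W :
  represents (@tens_index 2) inv_sqrt2 (wFL sg) (W_eta R M sg eta).
Proof.
rewrite -[inv_sqrt2]mulr1 -[X in represents _ X]mul1r.
apply: (represents_mul hN phase_neq0 (tens_index_bij 2)).
  exact/represents_tens/entries_F.
exact/represents_scaler/represents_L.
Qed.

(** The scalar is [4^-1] rather than the [2^-1] of [represents_S], to agree with [represents_h]: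
    bonds and seams can then be added symbolically. *)
Lemma represents_S_eta :
  represents (@tens_index (2 * 2)) 4^-1 (wFSF sg) (S_eta R M sg eta).
Proof.
have rFB : represents (@tens_index (2 * 2)) 1 (mtens mid (wF sg))
    (1%:M *t F R sg eta *t 1%:M).
  exact/represents_tens/entries_tens/entries_F/entries_one.
have -> : 4^-1 = 1 * 4^-1 * Num.conj 1 :> C by rewrite conjC1 mul1r mulr1.
have rmul := represents_mul hN phase_neq0 (tens_index_bij (2 * 2)).
apply: (rmul); last exact: (represents_dag hN conj_phase rFB).
apply: (rmul) => //; apply: represents_rescale.
have -> : 2%:~R * 4^-1 = 2^-1 :> C; last exact: represents_S.
by rewrite [4](natrM _ 2 2) invfM mulrA mulfV ?mul1r // pnatr_eq0.
Qed.

End LocalRepresentations.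

(** * Three sites *)

(* The block index of [C^2_A (x) C^2_B (x) C^2_C] is the binary number [abc]. *)
Definition bit (u i : nat) : nat := ((i %/ 2 ^ (2 - u)) %% 2)%N.
(** Computable counterpart of [agree_off] for configurations of three spins coded by their binary
    number. *)
Definition agree (us : seq nat) (i j : nat) : bool :=
  all (fun v => (v \in us) || (bit v i == bit v j)) [:: 0; 1; 2]%N.
Definition won1 (u : nat) (g : wmat) : wmat :=
  fun i j => if agree [:: u] i j then g (bit u i) (bit u j) else [::].
Definition won2 (u v : nat) (g : wmat) : wmat :=
  fun i j => if agree [:: u; v] i j
    then g (bit u i * 2 + bit v i)%N (bit u j * 2 + bit v j)%N else [::].

Section ThreeSites.
Variables (R : realType) (N M : nat) (sg : sgn) (eta : 'Z_(2 * N)).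
Hypothesis hN : (1 < N)%N.
Local Notation C := R[i].
Local Notation f := (eps R N ^+ eta).
Local Notation W := (W_eta R M sg eta).
Local Notation S := (S_eta R M sg eta).
Local Notation h := (h R N M).
Notation represents := (represents M f).

Definition spins (i : 'I_8) : {ffun 'I_3 -> 'I_2} := [ffun u : 'I_3 => inord (bit u i)].
Definition site_index (i : 'I_8) (m : 'Z_N) : 'I_#|basis N 'I_3| := enum_rank (spins i, m).

Lemma spinsE i u : spins i u = bit u i :> nat.
Proof. by rewrite ffunE inordK // ltn_mod. Qed.

Lemma spins_inj : injective spins.
Proof.
have binary (i : 'I_8) : val i = (bit 0 i * 4 + bit 1 i * 2 + bit 2 i)%N.
  by case: i; do 8 case=> //.
move=> i j ij; apply: val_inj; rewrite [LHS]binary [RHS]binary.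
have bitE (u : 'I_3) : bit u i = bit u j by rewrite -!spinsE ij.
by rewrite (bitE sA) (bitE sB) (bitE sC).
Qed.

Lemma site_index_bij : bijective (fun x : 'I_8 * 'Z_N => site_index x.1 x.2).
Proof.
apply: inj_card_bij => [[i m] [j n] /enum_rank_inj [/spins_inj -> ->] //|].
by rewrite card_ord card_prod card_ffun !card_prod !card_ord.
Qed.

Lemma agree_spins (A : {set 'I_3}) us i j :
  (forall u, (u \in A) = (val u \in us)) ->
  agree_off A (spins i) (spins j) = agree us i j.
Proof.
move=> Aus; apply/forallP/allP => [ij v|ij u]; last first.
  rewrite Aus; have := ij u; rewrite -val_eqE /= !spinsE implyNb; apply.
  by case: u; do 3 case=> //.
move=> v3; have lt3 : (v < 3)%N by move: v3; rewrite !inE => /or3P [] /eqP ->.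
by have := ij (Ordinal lt3); rewrite Aus -val_eqE /= !spinsE implyNb.
Qed.

Lemma represents_on1a (u : 'I_3) c g O :
  represents (@tens_index N 2) c g O -> represents site_index c (won1 u g) (on1a u O).
Proof.
move=> gO i j; rewrite /won1 -(@agree_spins [set u]) => [|v]; last by rewrite !inE.
have := gO (spins i u) (spins j u); rewrite !spinsE => bij.
apply/matrixP => m n; rewrite mxE [LHS]mxE !enum_rankK /=.
case: agree_off; last by rewrite mulr0n ev_nil scaler0 mxE.
by rewrite mulr1n -bij mxE.
Qed.

Lemma represents_on2a (u v : 'I_3) c g O :
  represents (@tens_index N (2 * 2)) c g O ->
  represents site_index c (won2 u v g) (on2a u v O).
Proof.
move=> gO i j; rewrite /won2 -(@agree_spins [set u; v]) => [|w]; last by rewrite !inE.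
have := gO (mxtens_index (spins i u, spins i v)) (mxtens_index (spins j u, spins j v)).
rewrite /= !spinsE => bij.
apply/matrixP => m n; rewrite mxE [LHS]mxE !enum_rankK /=.
case: agree_off; last by rewrite mulr0n ev_nil scaler0 mxE.
by rewrite mulr1n -bij mxE.
Qed.

Let rmul := represents_mul (M := M) hN (phase_neq0 R eta) site_index_bij.
Let rdag := represents_dag (M := M) hN (conj_phase R eta).

Lemma sqrt2_norm : Num.conj (inv_sqrt2 R) * inv_sqrt2 R = 2^-1.
Proof.
rewrite /inv_sqrt2 -[Num.conj _]/(conjc _) conjc_real -rmorphM /= -invfM.
by rewrite -expr2 sqr_sqrtr // fmorphV rmorph_nat.
Qed.

Lemma W_unitary3 (u : 'I_3) : dag (on1a u W) *m on1a u W = 1%:M.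
Proof.
have rW := represents_on1a u (represents_W R M sg eta hN).
have := rmul (rdag rW) rW; rewrite sqrt2_norm => rWW.
(* The product carries the scalar [2^-1], so the identity is represented as [2^-1] times the
   symbolic matrix [mscale 2 mid]. *)
apply: (represents_eq site_index_bij rWW (g' := mscale 2 mid)).
  apply: represents_rescale; rewrite mulfV ?pnatr_eq0 //.
  exact: represents_one site_index_bij.
(* Once the site and the sign are concrete, the test is a closed boolean in which [N], [M] and [eta]
   no longer occur. *)
by case: u {rW rWW} => [[|[|[|]]] u3] //; case: sg; vm_compute.
Qed.

Lemma W_commutes3 :
  on2 N sB sC h *m on1a sA W = on1a sA W *m on2 N sB sC h.
Proof.
have rW := represents_on1a sA (represents_W R M sg eta hN).
have rh := represents_on2a sB sC (represents_h R M eta hN).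
have rl := rmul rh rW; have := rmul rW rh; rewrite mulrC => rr.
by apply: (represents_eq site_index_bij rl rr); case: sg; vm_compute.
Qed.

(** The one place where the coefficients of gate, bond and seam have to match. The symbolic check
    keeps [q] and [f] formal, so it covers every [eta]. *)
Lemma intertwine3 :
  dag (on1a sB W) *m (on2 N sB sC h + on2a sA sB S) *m on1a sB W
  = on2 N sA sB h + on2a sB sC S.
Proof.
have rW := represents_on1a sB (represents_W R M sg eta hN).
have rl := represents_add (represents_on2a sB sC (represents_h R M eta hN))
  (represents_on2a sA sB (represents_S_eta R M sg eta hN)).
have rr := represents_add (represents_on2a sA sB (represents_h R M eta hN))
  (represents_on2a sB sC (represents_S_eta R M sg eta hN)).
have := rmul (rmul (rdag rW) rl) rW; rewrite mulrAC sqrt2_norm => rWlW.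
(* The two gates contribute [2^-1] on the left, compensated by doubling the polynomials on the
   right. *)
apply: (represents_eq site_index_bij rWlW (g' := mscale 2 _)).
  by apply: represents_rescale; rewrite mulrA mulfV ?pnatr_eq0 // mul1r; exact: rr.
by case: sg; vm_compute.
Qed.

Lemma S_eta_hermitian : S \is hermsymmx.
Proof.
have rS := represents_S_eta R M sg eta hN.
apply/is_hermitianmxP; rewrite expr0 scale1r.
have := rdag rS; rewrite fmorphV /= conjC_nat => rdS.
apply: (represents_eq (tens_index_bij N _) rS rdS).
by case: sg; vm_compute.
Qed.

(** The seam has only off-diagonal spin blocks, and conjugation by the diagonal [F] creates no
    others. *)
Lemma S_eta_traceless : \tr S = 0.
Proof.
apply: (represents_tr0 (tens_index_bij N _) (represents_S_eta R M sg eta hN)).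
by case: sg; vm_compute.
Qed.

End ThreeSites.

(** * Extension to an arbitrary set of sites *)

Lemma agree_offP (T : finType) (A : {set T}) (s t : {ffun T -> 'I_2}) :
  reflect (forall l, l \notin A -> s l = t l) (agree_off A s t).
Proof.
apply: (iffP forallP) => st l; last by apply/implyP => lA; apply/eqP/st.
by move=> lA; apply/eqP/(implyP (st l)).
Qed.

Lemma agree_off_sym (T : finType) (A : {set T}) (s t : {ffun T -> 'I_2}) :
  agree_off A s t = agree_off A t s.
Proof. by apply: eq_forallb => l; rewrite eq_sym. Qed.

Section Lift.
Variables (R : realType) (N : nat) (U T : finType) (iota : U -> T).
Hypothesis iota_inj : injective iota.
Local Notation C := R[i].
Local Notation conf V := {ffun V -> 'I_2}.

Definition restrict (s : conf T) : conf U := [ffun u => s (iota u)].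
(** For fixed [s], this parametrises by [c] the configurations that agree with [s] off the image of
    [iota]. *)
Definition extend (s : conf T) (c : conf U) : conf T :=
  [ffun l => if [pick u | iota u == l] is Some u then c u else s l].
Local Notation img := (iota @: [set: U]).

Lemma restrict_extend s c : restrict (extend s c) = c.
Proof.
apply/ffunP => u; rewrite !ffunE; case: pickP => [v /eqP /iota_inj -> //|].
by move/(_ u); rewrite eqxx.
Qed.

Lemma extend_restrict s t : agree_off img s t -> extend s (restrict t) = t.
Proof.
move/agree_offP => st; apply/ffunP => l; rewrite ffunE.
case: pickP => [u /eqP <-|nl]; first by rewrite ffunE.
by apply: st; apply/imsetP => -[u _ lu]; have := nl u; rewrite lu eqxx.
Qed.

Lemma agree_extend s c : agree_off img s (extend s c).
Proof.
apply/agree_offP => l lU; rewrite ffunE; case: pickP => // u /eqP ul.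
by rewrite -ul imset_f in lU.
Qed.

Lemma agree_restrict (A : {set U}) s t :
  agree_off A (restrict s) (restrict t) && agree_off img s t
  = agree_off (iota @: A) s t.
Proof.
apply/andP/agree_offP => [[/agree_offP stA /agree_offP st] l lA|st].
  have [/imsetP [u _ lu]|] := boolP (l \in img); last exact: st.
  have /stA : u \notin A by apply: contra lA => uA; rewrite lu imset_f.
  by rewrite !ffunE -lu.
split; apply/agree_offP => l lA; last first.
  by apply: st; apply: contra lA => /imsetP [u _ ->]; rewrite imset_f.
by rewrite !ffunE; apply: st; rewrite mem_imset.
Qed.

(** This is [P] on the image of [iota] and on the endpoint, tensored with the identity on all other
    sites. *)
Definition lift_op (P : op R N U) : op R N T :=
  \matrix_(i, j)
    let s : basis N T := enum_val i in let t : basis N T := enum_val j in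
    P (enum_rank (restrict s.1, s.2)) (enum_rank (restrict t.1, t.2))
      *+ agree_off img s.1 t.1.

Lemma lift_opD P Q : lift_op (P + Q) = lift_op P + lift_op Q.
Proof. by apply/matrixP => i j; rewrite !mxE /= mxE mulrnDl. Qed.

Lemma lift_op_dag P : lift_op (dag P) = dag (lift_op P).
Proof. by apply/matrixP => i j; rewrite !mxE /= !mxE rmorphMn agree_off_sym. Qed.

Lemma lift_op1 : lift_op 1%:M = 1%:M.
Proof.
apply/matrixP => i j; rewrite !mxE /= mxE (inj_eq enum_rank_inj) -(inj_eq enum_val_inj).
case: (enum_val i) (enum_val j) => s m [t n] /=; rewrite !xpair_eqE.
have -> : (s == t) = (restrict s == restrict t) && agree_off img s t.
  apply/eqP/andP => [->|[/eqP rst /extend_restrict <-]].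
    by split=> //; apply/agree_offP.
  by rewrite -rst extend_restrict //; apply/agree_offP.
by case: agree_off; rewrite ?andbT ?andbF.
Qed.

(** In the product of the lifts only intermediate configurations agreeing with the row off the image
    contribute, and [extend] identifies them with configurations on [U]. *)
Lemma lift_opM P Q : lift_op (P *m Q) = lift_op P *m lift_op Q.
Proof.
apply/matrixP => i j; rewrite mxE /= mxE [RHS]mxE.
rewrite (reindex (@enum_rank (basis N U))) /=; last exact/onW_bij/enum_rank_bij.
rewrite [RHS](reindex (@enum_rank (basis N T))) /=; last exact/onW_bij/enum_rank_bij.
set s := enum_val i; set t := enum_val j.
rewrite [RHS](bigID (fun b : basis N T => agree_off img s.1 b.1)) /=.
rewrite [X in _ = _ + X]big1 ?addr0 => [|b /negbTE nsb]; last first.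
  by rewrite mxE enum_rankK /= nsb mul0r.
rewrite (reindex_onto (fun c : basis N U => (extend s.1 c.1, c.2))
  (fun b : basis N T => (restrict b.1, b.2))) /=; last first.
  by move=> [b m] /= sb; rewrite extend_restrict.
rewrite -sumrMnl; apply: eq_big => [c|c _].
  by rewrite agree_extend restrict_extend -surjective_pairing eqxx.
rewrite !mxE !enum_rankK /= restrict_extend -surjective_pairing agree_extend mulr1n.
(* What remains is that [t] agrees off the image with [s] exactly when it agrees there with the
   extension of [s]. *)
rewrite -mulrnAr; congr (_ * (_ *+ _)); congr nat_of_bool.
apply/agree_offP/agree_offP => st l lU; have := st l lU.
  by rewrite (agree_offP _ _ _ (agree_extend s.1 c.1) l lU).
by rewrite (agree_offP _ _ _ (agree_extend s.1 c.1) l lU).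
Qed.

Lemma lift_on1a u (O : 'M[C]_(2 * edim N)) : lift_op (on1a u O) = on1a (iota u) O.
Proof.
apply/matrixP => i j; rewrite !mxE /= mxE !enum_rankK /= !ffunE -mulrnA mulnb.
by rewrite agree_restrict imset_set1.
Qed.

Lemma lift_on2a u v (O : 'M[C]_(2 * 2 * edim N)) :
  lift_op (on2a u v O) = on2a (iota u) (iota v) O.
Proof.
apply/matrixP => i j; rewrite !mxE /= mxE !enum_rankK /= !ffunE -mulrnA mulnb.
by rewrite agree_restrict imsetU !imset_set1.
Qed.

End Lift.

(** * From three sites to the ring *)

Section RingTransport.
Variables (R : realType) (N M : nat) (sg : sgn) (eta : 'Z_(2 * N)).
Hypothesis hN : (1 < N)%N.
Variables (T : finType) (a b c : T).
Hypotheses (ab : a != b) (bc : b != c) (ac : a != c).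
Local Notation W := (W_eta R M sg eta).
Local Notation S := (S_eta R M sg eta).
Local Notation h := (h R N M).

Definition three (u : 'I_3) : T := nth a [:: a; b; c] u.

Lemma three_inj : injective three.
Proof.
move=> u v uv; apply/val_inj/eqP.
by rewrite -(nth_uniq a (s := [:: a; b; c])) //= ?inE ?negb_or ?ab ?ac ?bc //; apply/eqP.
Qed.

Lemma W_unitary : dag (on1a a W) *m on1a a W = 1%:M.
Proof.
have := congr1 (lift_op three) (W_unitary3 R M sg eta hN sA).
by rewrite (lift_opM three_inj) lift_op_dag (lift_on1a three_inj) lift_op1.
Qed.

Lemma W_commutes : on2 N b c h *m on1a a W = on1a a W *m on2 N b c h.
Proof.
have := congr1 (lift_op three) (W_commutes3 R M sg eta hN).
by rewrite !(lift_opM three_inj) !(lift_on1a three_inj) !(lift_on2a three_inj).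
Qed.

Lemma intertwine :
  dag (on1a b W) *m (on2 N b c h + on2a a b S) *m on1a b W
  = on2 N a b h + on2a b c S.
Proof.
have := congr1 (lift_op three) (intertwine3 R M sg eta hN).
by rewrite !(lift_opM three_inj) lift_op_dag !lift_opD !(lift_on1a three_inj)
  !(lift_on2a three_inj).
Qed.

End RingTransport.

Lemma ring_transport (R : realType) (N M L : nat) (sg : sgn) (eta : 'Z_(2 * N)) (k : 'Z_L) :
  (1 < N)%N -> (2 < L)%N ->
  dag (G_eta R M sg eta k) *m H_eta R M sg eta k *m G_eta R M sg eta k
  = H_eta R M sg eta (k + 1).
Proof.
move=> hN hL.
have n1 : (1 : 'Z_L) != 0 by [].
(* Here [2 < L] enters: it separates [k - 1] from [k + 1], so that [k - 1], [k], [k + 1] are three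
   distinct sites. *)
have n2 : (1 + 1 : 'Z_L) != 0.
  by rewrite -val_eqE /= Zp_cast ?(ltnW hL) // !modn_small // ltnW.
have kS (j : 'Z_L) : j != j + 1 by rewrite -subr_eq0 opprD addrA subrr sub0r oppr_eq0.
have kP : k - 1 != k by rewrite -subr_eq0 addrAC subrr sub0r oppr_eq0.
have kPS : k - 1 != k + 1 by rewrite -subr_eq0 opprD addrACA subrr add0r -opprD oppr_eq0.
rewrite /H_eta (bigD1 k) /=; last by rewrite eq_sym.
(* The seam before transport leaves out the bond at [k - 1], the one after it the bond at [k].
   Isolating the bond at [k] on the left and that at [k - 1] on the right leaves sums over the same
   [j]. *)
rewrite [in RHS]addrK (bigD1 (k - 1) (P := fun j => j != k)) //= subrK.
rewrite [in RHS](eq_bigl (fun j => (j != k - 1) && (j != k))) => [|j]; last exact: andbC.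
rewrite addrAC mulmxDr mulmxDl (intertwine R M sg eta hN kP (kS k) kPS).
rewrite [RHS]addrAC; congr (_ + _); rewrite mulmx_sumr mulmx_suml.
apply: eq_bigr => j /andP [jP jk].
have kj : k != j + 1 by rewrite -subr_eq eq_sym.
(* The bond from [j] to [j + 1] does not touch [k]: the gate passes through it and cancels against
   its adjoint. *)
rewrite -mulmxA (W_commutes R M sg eta hN _ (kS j) kj); last by rewrite eq_sym.
by rewrite mulmxA (W_unitary R M sg eta hN _ (kS j) kj) ?mul1mx // eq_sym.
Qed.

Unset Implicit Arguments.

Theorem theorem3p3 (R : realType) (N M : nat)
  (hN : (2 <= N)%N) (hM1 : (1 <= M)%N) (hMN : (M < N)%N) (hcop : coprime M N)
  (sg : sgn) :
  [/\ S_VMY R N M sg \is hermsymmx,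
      \tr (S_VMY R N M sg) = 0,
      dag (on1a sB (W_VMY R N M sg))
        *m (on2 N sB sC (h R N M) + on2a sA sB (S_VMY R N M sg))
        *m on1a sB (W_VMY R N M sg)
      = on2 N sA sB (h R N M) + on2a sB sC (S_VMY R N M sg)
    & forall L : nat, (3 <= L)%N ->
      [/\ forall (eta : 'Z_(2 * N)) (k : 'Z_L),
            dag (G_eta R M sg eta k) *m H_eta R M sg eta k *m G_eta R M sg eta k
            = H_eta R M sg eta (k + 1),
          forall k : 'Z_L,
            dag (G_Weyl R N M sg k) *m H_Weyl R N M sg k *m G_Weyl R N M sg k
            = H_Weyl R N M sg (k + 1)
        & forall k : 'Z_L,
            dag (G_VMY R N M sg k) *m H_VMY R N M sg k *m G_VMY R N M sg k
            = H_VMY R N M sg (k + 1)]].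
Proof.
split.
- exact: S_eta_hermitian.
- exact: S_eta_traceless.
- exact: intertwine3.
(* The Weyl and source-normalized statements are, by definition, the cases of [eta] equal to [0] and
   to [eta_VMY]. *)
- by move=> L hL; split=> *; apply: ring_transport.
Qed.
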